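(* For all $n\in\mathbb{N}$ (where $0\in\mathbb{N}$), we have $g_2(n)=2n$ if and only if one of the following holds: (1) $n>3$ is prime; (2) $n=0$; (3) $n=6$.
   Context: $\mathbb{N}=\{0,1,2,\dots\}$. For an integer $m\ge 2$, an $m$-product sequence is a finite sequence of integers $a_1\le a_2\le\dots\le a_t$ such that $\prod_{i=1}^t a_i=R^m$ for some $R\in\mathbb{N}$ and no integer appears more than $m-1$ times in the sequence. For $n\in\mathbb{N}$, $g_m(n)$ is the least integer $s$ such that there exists an $m$-product sequence $a_1\le\dots\le a_t$ with $a_1=n$ and $a_t=s$. (Thus $g_2(n)$ is the least $s\ge n$ such that $n$ times a product of distinct integers in $(n,s]$ is a perfect square.) *)

(* Defs.v *)
From mathcomp Require Import all_boot all_order all_algebra.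
From mathcomp Require Import boolp classical_sets.

Set Implicit Arguments.
Unset Strict Implicit.
Unset Printing Implicit Defensive.

Import Order.TTheory GRing.Theory Num.Theory.
Local Open Scope ring_scope.

Definition product_seq (m : nat) (a : seq int) : Prop :=
  [/\ sorted <=%R a,
      exists R : nat, \prod_(x <- a) x = R%:Z ^+ m
    & forall x : int, (count_mem x a <= m.-1)%N].

Definition reachable (m n : nat) (s : int) : Prop :=
  exists2 b : seq int, product_seq m (n%:Z :: b) & last n%:Z b = s.

Definition is_g (m n : nat) (s : int) : Prop :=
  reachable m n s /\ forall s' : int, reachable m n s' -> s <= s'.

(* For m >= 2 the least element exists (lemma gP), so the default value 0
   is never used; for m < 2 the value of g is meaningless. *)
Definition g (m n : nat) : int := xget 0 [set s | is_g m n s]%classic.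

Lemma reachable_ge (m n : nat) (s : int) : reachable m n s -> n%:Z <= s.
Proof.
move=> [b [srt _ _] <-].
have /allP h : all (<=%R n%:Z) b by apply: order_path_min srt; exact: le_trans.
by have := mem_last n%:Z b; rewrite inE => /orP[/eqP-> //|/h].
Qed.

Lemma reachable_ex (m n : nat) : (1 < m)%N -> exists s, reachable m n s.
Proof.
case: m => [|m]// m_gt0; case: n => [|n].
  exists 0, [::] => //; split=> [//||x].
    by exists 0%N; rewrite big_seq1 expr0n.
  by rewrite /= addn0; case: eqP.
pose k : int := 2 ^+ m.+1 * n.+1%:Z.
have ltk : n.+1%:Z < k.
  by rewrite /k ltr_pMl// exprn_egt1.
exists (last n.+1%:Z (nseq m k)), (nseq m k) => //; split.
- rewrite /= path_sortedE; last exact: le_trans.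
  rewrite all_nseq ltW// orbT/=.
  have srt j : sorted <=%R (nseq j k) by elim: j => // -[|j] //= ->; rewrite lexx.
  exact: srt.
- exists (2 ^ m * n.+1)%N; rewrite big_cons big_nseq iter_mulr_1.
  rewrite /k exprMn -exprM mulrCA -exprS PoszM exprMn.
  by rewrite -[Posz (2 ^ m)]natz natrX -exprM mulnC.
- move=> x /=; rewrite count_nseq /=.
  case: eqP => [<-|_]; first by rewrite (gt_eqF ltk) mul0n addn0.
  by case: (k == x); rewrite ?mul1n ?mul0n.
Qed.

Lemma gP (m n : nat) : (1 < m)%N -> is_g m n (g m n).
Proof.
move=> m_gt1; suff [s sP] : exists s, is_g m n s by exact: (xgetI 0 sP).
have ex : exists k : nat, `[< reachable m n k%:Z >].
  have [s hs] := reachable_ex n m_gt1.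
  have s0 : 0 <= s by apply: le_trans (reachable_ge hs).
  by exists `|s|%N; apply/asboolP; rewrite gez0_abs.
case: (ex_minnP ex) => k /asboolP hk kmin; exists k%:Z; split=> // s hs.
have s0 : 0 <= s by apply: le_trans (reachable_ge hs).
by rewrite -(gez0_abs s0) lez_nat; apply: kmin; apply/asboolP; rewrite gez0_abs.
Qed.

(* Main.v *)
Require Import Defs.
From mathcomp Require Import all_boot all_order all_algebra.
From mathcomp Require Import zify.

(* If [n = a b] with [1 < a < b], then [ab, a(b+1), (a+1)b, (a+1)(b+1)] has square
    product, and its last term is below [2n] unless [(a, b) = (2, 3)]; a composite
    square is a product sequence on its own. If [n = p > 3] is prime, a second
    multiple of [p] is needed, so [2p] is a lower bound; it is attained by
    [p, 2k^2, 2p] where [k^2] is a square strictly between [p/2] and [p]. *)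


Import Order.TTheory GRing.Theory Num.Theory.

Lemma logn_prod_even {p : nat} {s : seq nat} :
  all (leq 1) s -> {in s, forall x, ~~ odd (logn p x)} ->
  ~~ odd (logn p (\prod_(x <- s) x)).
Proof.
elim: s => [|x s IHs] /=; first by rewrite big_nil logn1.
move=> /andP[x_gt0 s_gt0] evs; rewrite big_cons lognM //; last first.
  by rewrite big_seq prodn_cond_gt0 // => y /(allP s_gt0).
rewrite oddD (negPf (evs x _)) ?mem_head // addFb IHs // => y ys.
by apply: evs; rewrite inE ys orbT.
Qed.

(** For [m = 2] the multiplicity bound forbids repetitions, so the sorted sequence is strictly
    increasing; starting at [n], it has no negative entry. Everything after this can be done in
    [nat]. *)
Lemma reachable_nat (n : nat) (s : int) :
  reachable 2 n s <->
  exists b : seq nat, [/\ path ltn n b, Posz (last n b) = s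
    & exists R : nat, n * \prod_(x <- b) x = R ^ 2].
Proof.
have prodE (b : seq nat) :
    (\prod_(x <- [seq Posz i | i <- n :: b]) x)%R = Posz (n * \prod_(x <- b) x).
  rewrite big_map big_cons PoszM; congr (_ * _)%R.
  by elim: b => [|x b IHb]; rewrite ?big_nil // !big_cons IHb PoszM.
have expE (R : nat) : (Posz R ^+ 2)%R = Posz (R ^ 2).
  by rewrite expr2 -PoszM mulnn.
split=> [[b [srt [R prodb] cnt] <-]|[b [pth <- [R prodb]]]].
- have Ub : uniq (Posz n :: b).
    apply: count_mem_uniq => x; apply/eqP.
    by rewrite eqn_leq; move: (cnt x); rewrite -has_pred1 has_count; lia.
  have lt_path : path (<%R) (Posz n) b.
    by have := lt_sorted_uniq_le (Posz n :: b); rewrite Ub srt.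
  have b_ge0 : {in b, forall x : int, Posz (absz x) = x}.
    move=> x xb; have /allP/(_ x xb) := order_path_min lt_trans lt_path.
    by rewrite /=; lia.
  have bE : b = [seq Posz i | i <- map absz b].
    by rewrite -map_comp -[LHS]map_id; apply/eq_in_map => x /b_ge0.
  exists (map absz b); move: bE lt_path prodb; move: (map absz b) => c ->.
  rewrite path_map last_map -map_cons prodE expE => pth [eqR].
  by split=> //; exists R.
- exists (map Posz b); last by rewrite last_map.
  have lt_srt : sorted (<%R) [seq Posz i | i <- n :: b].
    by rewrite /= path_map.
  split.
  + by rewrite lt_sorted_uniq_le in lt_srt; case/andP: lt_srt.
  + by exists R; rewrite -map_cons prodE prodb expE.
  + move=> x; rewrite -map_cons count_uniq_mem ?leq_b1 //.
    by rewrite lt_sorted_uniq_le in lt_srt; case/andP: lt_srt.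
Qed.

(** The exponent of [p] in a square is even, so a single term with odd exponent cannot occur:
    another one must compensate it. *)
Lemma odd_logn_partner {p n y : nat} {b : seq nat} :
  0 < n -> path ltn n b -> (exists R, n * \prod_(x <- b) x = R ^ 2) ->
  y \in n :: b -> odd (logn p y) ->
  exists x, [/\ x != y, n <= x <= last n b & odd (logn p x)].
Proof.
move=> n_gt0 pth [R prodb] yb oddy.
have lt_srt : sorted ltn (n :: b) by [].
have Ub : uniq (n :: b) by rewrite ltn_sorted_uniq_leq in lt_srt; case/andP: lt_srt.
have ge_n x : x \in n :: b -> n <= x.
  rewrite inE => /orP[/eqP-> //|xb].
  by have /allP/(_ x xb)/ltnW := order_path_min ltn_trans pth.
have le_last x : x \in n :: b -> x <= last n b.
  move: {yb oddy Ub prodb lt_srt ge_n n_gt0} n pth x.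
  elim: b => [|z b IHb] n /=; first by move=> _ x; rewrite inE => /eqP->.
  move=> /andP[ltnz pth] x; rewrite inE => /orP[/eqP->|]; last exact: IHb.
  by rewrite (leq_trans (ltnW ltnz)) // IHb ?mem_head.
have [/hasP[x]|/hasPn evs] := boolP (has (fun x => odd (logn p x)) (rem y (n :: b))).
  rewrite mem_rem_uniq // inE => /andP[neq xb] oddx.
  by exists x; rewrite ge_n ?le_last.
(* Otherwise the terms other than [y] contribute an even exponent and the total is odd. Additivity
   of [logn] requires positive factors. *)
have rem_gt0 : all (leq 1) (rem y (n :: b)).
  by apply/allP => x /mem_rem/ge_n; apply: leq_trans.
have prodE : y * \prod_(x <- rem y (n :: b)) x = R ^ 2.
  have := perm_big _ (perm_to_rem yb) : \prod_(x <- n :: b) x = _.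
  by rewrite !big_cons prodb.
have := logn_prod_even rem_gt0 evs; have := congr1 (fun k => odd (logn p k)) prodE.
rewrite lognM; first by rewrite oddD oddy lognX oddM /= => /negPn ->.
  by apply: leq_trans n_gt0 (ge_n _ yb).
by rewrite big_seq prodn_cond_gt0 // => x /(allP rem_gt0).
Qed.

Lemma composite_reachable {n : nat} : 3 < n -> ~~ prime n -> n != 6 ->
  exists2 s : nat, reachable 2 n (Posz s) & s < 2 * n.
Proof.
move=> n_gt3 /primePn[|[d /andP[d_gt1 ltdn] /dvdnP[e nE]]]; first by lia.
have [a [b [a_gt1 leab {}nE]]] : exists a b, [/\ 1 < a, a <= b & n = a * b].
  by case: (leqP d e) => h; [exists d, e | exists e, d]; split; nia.
move: leab; rewrite leq_eqVlt => /orP[/eqP eqab|ltab] n_neq6.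
  exists n; last lia.
  by apply/reachable_nat; exists [::]; split=> //; exists a; rewrite big_nil; lia.
(* [(a+1)(b+1) < 2ab] amounts to [(a-1)(b-1) > 2], which for [1 < a < b] fails only at [(2, 3)],
   that is, [n = 6]. *)
exists (a.+1 * b.+1); last by nia.
apply/reachable_nat; exists [:: a * b.+1; a.+1 * b; a.+1 * b.+1]; split=> //=.
  by rewrite andbT; apply/and3P; split; nia.
exists (a * b * a.+1 * b.+1); rewrite !big_cons big_nil nE; lia.
Qed.

(** Take the largest [k] with [k^2 < p]. Then [p <= (k+1)^2 <= 2k^2] as soon as [k >= 3], and parity
    excludes [p = 2k^2]. The small primes 5 and 7 lie between 4 and 8. *)
Lemma square_between {p : nat} : 3 < p -> prime p -> exists k, k ^ 2 < p < 2 * k ^ 2.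
Proof.
move=> p_gt3 pr_p.
have [p_small|p_big] := leqP p 9.
  by exists 2; move: p_gt3 pr_p p_small; do 10?[case: p => [//|p]].
have ex : exists k, k ^ 2 < p by exists 0; lia.
have bound k : k ^ 2 < p -> k <= p by nia.
case: (ex_maxnP ex bound) => k ltk kmax; exists k.
have : p <= k.+1 ^ 2 by rewrite leqNgt; apply/negP => /kmax; rewrite ltnn.
rewrite ltk /= => lek; have k_ge3 : 3 <= k by apply: kmax.
rewrite ltn_neqAle; apply/andP; split; last by nia.
by apply: contraTneq pr_p => ->; apply/negP => /even_prime[|]; [nia | rewrite oddM].
Qed.

Lemma prime_reachable {p : nat} : 3 < p -> prime p -> reachable 2 p (Posz (2 * p)).
Proof.
move=> p_gt3 pr_p; have [k /andP[ltkp ltpk]] := square_between p_gt3 pr_p.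
apply/reachable_nat; exists [:: 2 * k ^ 2; 2 * p]; split=> //=.
  by rewrite andbT; apply/andP; split; lia.
exists (2 * k * p); rewrite !big_cons big_nil; lia.
Qed.

(** The compensating term for [n] lies beyond [n] and at most at [s], but cannot lie below [m]. *)
Lemma reachable_lower_bound {p n s m : nat} :
  0 < n -> odd (logn p n) ->
  (forall x, n < x < m -> ~~ odd (logn p x)) ->
  reachable 2 n (Posz s) -> m <= s.
Proof.
move=> n_gt0 oddn ev /reachable_nat[b [pth [<-] sq]].
have [x [neq /andP[gex lex] oddx]] :=
  odd_logn_partner n_gt0 pth sq (mem_head n b) oddn.
rewrite leqNgt; apply: contraL oddx => lts; apply: ev.
by rewrite ltn_neqAle eq_sym neq gex (leq_ltn_trans lex lts).
Qed.

Lemma g_eq {n s : nat} : reachable 2 n (Posz s) ->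
  (forall s', reachable 2 n (Posz s') -> s <= s') -> g 2 n = Posz s.
Proof.
move=> rs mins; have [rg ming] := @gP 2 n isT.
apply: le_anti; rewrite ming //=.
have := reachable_ge rg; case: (g 2 n) rg => // k rg _.
by rewrite lez_nat mins.
Qed.

Theorem theorem3p4 (n : nat) :
  g 2 n = Posz (2 * n)%N <-> [\/ (3 < n)%N /\ prime n, n = 0%N | n = 6%N].
Proof.
split=> [gE|].
- have [rg ming] := @gP 2 n isT; rewrite gE in rg ming.
  case: (posnP n) => [n0|n_gt0]; first exact: Or32.
  have [n_gt3|n_le3] := ltnP 3 n; last first.
    exfalso; move: rg ming; rewrite {gE}.
    case: n n_gt0 n_le3 => [//|[|[|[|//]]]] _ _ rg ming.
    (* The one-term sequence 1 is already a square. *)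
    + have /ming // : reachable 2 1 1.
      by apply/reachable_nat; exists [::]; split=> //; exists 1; rewrite big_nil.
    (* The exponent of 2 is odd in 2 but even in 3 and 4. *)
    + suff : 5 <= 2 * 2 by [].
      by apply: (@reachable_lower_bound 2 2) rg => // -[|[|[|[|[|]]]]].
    + case/reachable_nat: rg => b [pth [lastE] sq].
      (* The prime 3 gives no contradiction, since 3 and 6 compensate each other. The prime 2 does:
         its exponent is odd in 6 but even in 3, 4 and 5. *)
      have b6 : 6 \in 3 :: b by rewrite -[6]lastE mem_last.
      have [x [neq]] := @odd_logn_partner 2 3 6 b isT pth sq b6 isT.
      by rewrite lastE; move: neq; case: x => [|[|[|[|[|[|[|x]]]]]]].
  have [->|n_neq6] := eqVneq n 6; first exact: Or33.
  apply: Or31; split=> //; apply/negPn/negP => n_comp.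
  have [s /ming rs lts] := composite_reachable n_gt3 n_comp n_neq6.
  by move: rs; rewrite lez_nat; lia.
- case=> [[n_gt3 pr_n]|->|->]; apply: g_eq => //.
  + exact: prime_reachable.
  + move=> s; apply: (@reachable_lower_bound n); rewrite ?logn_prime ?eqxx //; first lia.
    move=> x /andP[ltnx ltx]; rewrite logn_coprime // prime_coprime //.
    (* No multiple of [n] lies strictly between [n] and [2n]. *)
    apply/negP => /dvdnP[k xE]; move: ltnx ltx; rewrite xE.
    by case: k {xE} => [|[|k]]; nia.
  + by apply/reachable_nat; exists [::]; split=> //; exists 0; rewrite big_nil.
  (* [6 * 8 * 12 = 24^2]. *)
  + apply/reachable_nat; exists [:: 8; 12]; split=> //.
    by exists 24; rewrite !big_cons big_nil.
  (* The only multiple of 3 strictly between 6 and 12 is 9, where the exponent of 3 is even. *)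
  + move=> s; apply: (@reachable_lower_bound 3) => // x.
    by do 12?[case: x => [//|x]].
Qed.
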